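(* Let $G$ be a compact group with identity component $G^\circ$, and let $L$ and $K$ be finite-dimensional continuous real $G$-representations. Set $V:=L^{G^\circ}$ and $U:=K^{G^\circ}$, and let \[ \rho_{V\oplus U}\colon G\longrightarrow \operatorname{GL}(V\oplus U) \] be the direct sum of the representations of $G$ on $V$ and $U$. Then the image $\rho_{V\oplus U}(G)$ is a finite group.
   Context: A representation of $G$ on a finite-dimensional real vector space $L$ is a continuous group homomorphism $\rho_L\colon G\to \operatorname{GL}(L)$. For a subgroup $H\le G$, $L^H:=\{v\in L:\rho_L(h)v=v\text{ for all }h\in H\}$. The subspaces $L^{G^\circ}\subseteq L$ and $K^{G^\circ}\subseteq K$ are $G$-invariant, so $G$ acts on them by restriction. *)

(* Defs.v *)
From HB Require Import structures.
From mathcomp Require Import all_boot all_order all_algebra.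
From mathcomp Require Import all_classical all_reals all_analysis.

Set Implicit Arguments.
Unset Strict Implicit.
Unset Printing Implicit Defensive.

Import Order.TTheory GRing.Theory Num.Theory.
Import numFieldNormedType.Exports.

Local Open Scope classical_set_scope.
Local Open Scope ring_scope.

(* No separation axiom is required of the topology. *)
HB.mixin Record Group_isTopologicalGroup G of Group G & Topological G := {
  mulg_continuous : continuous (fun x : G * G => (x.1 * x.2)%g);
  invg_continuous : continuous (fun x : G => (x^-1)%g)
}.

#[short(type="topGroupType")]
HB.structure Definition TopologicalGroup :=
  {G of Group G & Topological G & Group_isTopologicalGroup G}.

Definition identity_component (G : topGroupType) : set G :=
  connected_component [set: G] 1%g.
Arguments identity_component G : clear implicits.

Definition is_subgroup (H : groupType) (A : set H) : Prop :=
  [/\ A 1%g, forall x y, A x -> A y -> A (x * y)%g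
    & forall x, A x -> A (x^-1)%g].

Section GeneralLinearGroup.
Variables (K : fieldType) (L : vectType K).

Record GL := MkGL { GLval :> 'End(L); GLvalP : lker GLval == 0%VS }.

HB.instance Definition _ := [isSub for GLval].
HB.instance Definition _ := [Choice of GL by <:].

Lemma GL_eqP (f g : GL) : f =1 g -> f = g.
Proof. by move=> fg; apply/val_inj/lfunP. Qed.

Lemma GL1_subproof : lker (\1%VF : 'End(L)) == 0%VS.
Proof. by apply/lker0P => u v; rewrite !id_lfunE. Qed.

Lemma GLM_subproof (f g : GL) : lker (f \o g)%VF == 0%VS.
Proof.
apply/lker0P => u v; rewrite !comp_lfunE.
by move=> /(lker0P (GLvalP f)) /(lker0P (GLvalP g)).
Qed.

Lemma GLV_subproof (f : GL) : lker (f^-1)%VF == 0%VS.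
Proof.
apply/lker0P => u v /(congr1 f).
by rewrite !(lker0_lfunVK (GLvalP f)).
Qed.

Definition GL1 := MkGL GL1_subproof.
Definition GLM f g := MkGL (GLM_subproof f g).
Definition GLV f := MkGL (GLV_subproof f).

Lemma GLMA : associative GLM.
Proof. by move=> f g h; apply/val_inj/comp_lfunA. Qed.
Lemma GL1M : left_id GL1 GLM.
Proof. by move=> f; apply/val_inj/comp_lfun1l. Qed.
Lemma GLM1 : right_id GL1 GLM.
Proof. by move=> f; apply/val_inj/comp_lfun1r. Qed.
Lemma GLVM : left_inverse GL1 GLV GLM.
Proof. by move=> f; apply/val_inj/(lker0_compVf (GLvalP f)). Qed.
Lemma GLMV : right_inverse GL1 GLV GLM.
Proof. by move=> f; apply/val_inj/(lker0_compfV (GLvalP f)). Qed.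

HB.instance Definition _ := isGroup.Build GL GLMA GL1M GLM1 GLVM GLMV.

Lemma GL_mulE (f g : GL) v : (f * g)%g v = f (g v).
Proof. exact: comp_lfunE. Qed.

Lemma GL_oneE v : (1%g : GL) v = v.
Proof. exact: id_lfunE. Qed.

Definition GLmx (f : GL) : 'M[K]_(\dim {:L}) :=
  passmx.mxof (vbasis {:L}) (vbasis {:L}) f.

End GeneralLinearGroup.

(* The topology of GL(L) is induced from that of real matrices through the
   choice of a basis of L. GL_continuousP characterizes the continuous maps into
   GL(L) without reference to a basis, so the choice does not matter. *)
HB.instance Definition _ (R : realType) (L : vectType R) :=
  Topological.copy (GL L) (initial_topology (@GLmx R L)).

Section Continuity.
Variables (R : realType) (L : vectType R) (T : topologicalType).

Lemma GL_continuousP (f : T -> GL L) :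
  continuous f <->
  forall (v : L) (phi : {scalar L}), continuous (fun t => phi (f t v) : R).
Proof.
pose e := vbasis {:L}.
have eB : basis_of {:L} e := vbasisP _.
split=> [fC v phi|fC].
  have mC : continuous (fun t => GLmx (f t)).
    by move=> t; apply: continuous_comp; [exact: fC|exact: initial_continuous].
  have -> : (fun t => phi (f t v) : R) = fun t => \sum_(i < \dim {:L})
      (\sum_(j < \dim {:L}) coord e j v * GLmx (f t) j i) * phi e`_i.
    apply/funext => t.
    rewrite -[f t v](passmx.rVofK eB) (passmx.rVof_app _ eB) linear_sum.
    apply: eq_bigr => i _; rewrite linearZ /= mxE; congr (_ * _).
    by apply: eq_bigr => j _; rewrite passmx.coord_rVof.
  have contMl (F : T -> R) c : continuous F -> continuous (fun t => c * F t).
    by move=> FC t; apply: cvgMl_tmp; exact: FC.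
  have contMr (F : T -> R) c : continuous F -> continuous (fun t => F t * c).
    by move=> FC t; apply: cvgMr_tmp; exact: FC.
  have contD : continuous (fun x : R * R => x.1 + x.2).
    exact: add_continuous.
  have contS (F : 'I_(\dim {:L}) -> T -> R) :
      (forall i, continuous (F i)) -> continuous (fun t => \sum_i F i t).
    by move=> FC t; apply: cvg_big => [|i _]; [exact: contD|exact: FC].
  apply: (contS) => i; apply: contMr; apply: (contS) => j; apply: contMl => t.
  exact: (@continuous_comp _ _ _ (fun t => GLmx (f t)) (fun M => M j i) t
    (mC t) (@coord_continuous R _ _ j i _)).
move=> t U /= [_ [[B Bo <-] /= Bft] BU].
have [P Pn PB] : nbhs (GLmx (f t)) B by exact: open_nbhs_nbhs.
apply: (@filterS _ _ _ [set s | forall i j, P i j (GLmx (f s) i j)]).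
  by move=> s Ps; apply: BU; exact: PB.
apply: filter_forall => i; apply: filter_forall => j.
have mxE' : (fun s => GLmx (f s) i j) = (fun s => coord e j (f s e`_i)).
  by apply/funext => s; rewrite mxE/= passmx.vecof_delta mxE.
have cij : {for t, continuous (fun s => GLmx (f s) i j)}.
  by rewrite mxE'; exact: fC.
by apply: cij; exact: Pn.
Qed.

End Continuity.

Record representation (R : realType) (G : topGroupType) (L : vectType R) :=
  Representation {
    rep_fun :> G -> GL L;
    repM : {morph rep_fun : x y / (x * y)%g};
    rep_continuous : continuous rep_fun
  }.

Section FixedSpace.
Variables (R : realType) (G : topGroupType) (L : vectType R).
Variable rho : representation G L.

Lemma rep1 : rho 1%g = 1%g.
Proof. by apply: (mulgI (rho 1%g)); rewrite -repM !mulg1. Qed.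

Lemma repVK (g : G) : cancel (rho g) (rho g^-1%g).
Proof. by move=> v; rewrite -GL_mulE -repM mulVg rep1 GL_oneE. Qed.

Lemma fixed_space_subproof (H : set G) :
  exists V : {vspace L},
    forall v, v \in V <-> forall h, H h -> rho h v = v.
Proof.
pose fixes (V : {vspace L}) := forall v, v \in V -> forall h, H h -> rho h v = v.
pose P n := `[< exists2 V : {vspace L}, fixes V & \dim V = n >].
have P0 : exists n, P n.
  exists 0%N; apply/asboolP; exists 0%VS; last exact: dimv0.
  by move=> v; rewrite memv0 => /eqP -> h _; rewrite linear0.
have Pb n : P n -> (n <= \dim {:L})%N.
  by move=> /asboolP[V _ <-]; exact: dimvS (subvf V).
have [n /asboolP[V Vfix dV] nmax] := ex_maxnP P0 Pb.
exists V => v; split=> [vV|vfix]; first exact: Vfix.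
suff fixVv : fixes (V + <[v]>)%VS.
  have : (\dim (V + <[v]>) <= \dim V)%N.
    by rewrite dV; apply: nmax; apply/asboolP; exists (V + <[v]>)%VS.
  have sVv := addvSl V <[v]>%VS.
  rewrite (geq_leqif (dimv_leqif_eq sVv)) => /eqP ->.
  by rewrite (subvP (addvSr V _))// memv_line.
move=> _ /memv_addP[u uV [_ /vlineP[k ->] ->]] h Hh.
by rewrite linearD linearZ/= (Vfix _ uV _ Hh) (vfix _ Hh).
Qed.

(* L^H, the subspace characterized by fixed_spaceP. *)
Definition fixed_space (H : set G) : {vspace L} :=
  projT1 (cid (fixed_space_subproof H)).

Lemma fixed_spaceP (H : set G) v :
  v \in fixed_space H <-> forall h, H h -> rho h v = v.
Proof. by rewrite /fixed_space; case: cid. Qed.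

Definition invariant_space (V : {vspace L}) : Prop :=
  forall g v, v \in V -> rho g v \in V.

Lemma identity_componentJ (g x : G) :
  identity_component G x -> identity_component G (x ^ g)%g.
Proof.
move=> Gx; pose c y := (y ^ g)%g.
apply: (@connected_component_max _ _ (c @` identity_component G)).
- exists 1%g; first exact: connected_component_refl.
  by rewrite /c conj1g.
- by [].
- apply: connected_continuous_connected; first exact: component_connected.
  have cM (f h : G -> G) : continuous f -> continuous h ->
      continuous (fun y => f y * h y)%g.
    move=> fC hC y.
    exact: (cvg_comp _ _ (cvg_pair (fC y) (hC y)) (@mulg_continuous G (f y, h y))).
  apply: continuous_subspaceT; rewrite /c /conjg.
  by apply: (cM) => [y|]; [exact: cvg_cst|apply: (cM) => y;
    [exact: cvg_id|exact: cvg_cst]].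
- by exists x.
Qed.

Lemma fixed_identity_component_invariant :
  invariant_space (fixed_space (identity_component G)).
Proof.
move=> g v /fixed_spaceP vfix; apply/fixed_spaceP => h Gh.
rewrite -[in RHS](vfix (h ^ g)%g); last exact: identity_componentJ.
by rewrite -!GL_mulE -!repM conjgE !mulgA mulgV mul1g.
Qed.

End FixedSpace.

Arguments fixed_identity_component_invariant {R G L} rho.

Section Subrepresentation.
Variables (R : realType) (G : topGroupType) (L : vectType R).
Variables (rho : representation G L) (V : {vspace L}).
Hypothesis Vinv : invariant_space rho V.

(* vsproj V is the identity on V and V is invariant, so this is the restriction
   of rho g to V, see subrepE. *)
Definition subrep_lfun (g : G) : 'End(subvs_of V) :=
  linfun (vsproj V \o rho g \o vsval).

Lemma subrep_lfunE g u : vsval (subrep_lfun g u) = rho g (vsval u).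
Proof. by rewrite lfunE/= vsprojK// Vinv// subvsP. Qed.

Lemma subrep_lker g : lker (subrep_lfun g) == 0%VS.
Proof.
apply/lker0P => u v /(congr1 vsval); rewrite !subrep_lfunE.
by move=> /(can_inj (repVK rho g)) /subvs_inj.
Qed.

Definition subrep_fun g : GL (subvs_of V) := MkGL (subrep_lker g).

Lemma subrepM : {morph subrep_fun : x y / (x * y)%g}.
Proof.
move=> x y; apply: GL_eqP => u; apply: subvs_inj.
by rewrite GL_mulE !subrep_lfunE repM GL_mulE.
Qed.

Lemma subrep_continuous : continuous subrep_fun.
Proof.
apply/GL_continuousP => u phi.
have := (GL_continuousP rho).1 (@rep_continuous _ _ _ rho) (vsval u)
  (phi \o vsproj V).
by under eq_fun do rewrite /= -subrep_lfunE vsvalK.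
Qed.

Definition subrep : representation G (subvs_of V) :=
  Representation subrepM subrep_continuous.

Lemma subrepE g u : vsval (subrep g u) = rho g (vsval u).
Proof. exact: subrep_lfunE. Qed.

End Subrepresentation.

Section DirectSum.
Variables (R : realType) (G : topGroupType) (L K : vectType R).
Variables (rhoL : representation G L) (rhoK : representation G K).

Definition dsum_map (g : G) (x : L * K) : L * K := (rhoL g x.1, rhoK g x.2).

Lemma dsum_map_linear g : linear (dsum_map g).
Proof. by move=> a x y; rewrite /dsum_map/= !linearP. Qed.

HB.instance Definition _ g :=
  GRing.isLinear.Build R (L * K)%type (L * K)%type _ (dsum_map g)
    (dsum_map_linear g).

Lemma dsum_lker g : lker (linfun (dsum_map g)) == 0%VS.
Proof.
apply/lker0P => -[a b] [c d]; rewrite !lfunE/= /dsum_map/=.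
by move=> [] /(can_inj (repVK rhoL g)) -> /(can_inj (repVK rhoK g)) ->.
Qed.

Definition dsum_fun g : GL (L * K)%type := MkGL (dsum_lker g).

Lemma dsum_funE g x : dsum_fun g x = (rhoL g x.1, rhoK g x.2).
Proof. exact: lfunE. Qed.

Lemma dsumM : {morph dsum_fun : x y / (x * y)%g}.
Proof.
move=> x y; apply: GL_eqP => u.
by rewrite GL_mulE !dsum_funE !repM !GL_mulE.
Qed.

Lemma dsum_continuous : continuous dsum_fun.
Proof.
apply/GL_continuousP => -[a b] phi.
pose inl (v : L) : L * K := (v, 0); pose inr (v : K) : L * K := (0, v).
have inlL : linear inl.
  by move=> k x y; congr pair; rewrite /= scaler0 addr0.
have inrL : linear inr.
  by move=> k x y; congr pair; rewrite /= scaler0 addr0.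
pose inlM := GRing.isLinear.Build _ _ _ _ inl inlL.
pose inrM := GRing.isLinear.Build _ _ _ _ inr inrL.
pose inl' : {linear L -> (L * K)%type} := HB.pack inl inlM.
pose inr' : {linear K -> (L * K)%type} := HB.pack inr inrM.
have cL := (GL_continuousP rhoL).1 (@rep_continuous _ _ _ rhoL) a (phi \o inl').
have cK := (GL_continuousP rhoK).1 (@rep_continuous _ _ _ rhoK) b (phi \o inr').
have -> : (fun t => phi (dsum_fun t (a, b)) : R) =
    (fun t => phi (inl (rhoL t a)) + phi (inr (rhoK t b))).
  apply/funext => t; rewrite dsum_funE/= -linearD; congr (phi _).
  by congr pair; rewrite /= ?addr0 ?add0r.
by move=> t; apply: cvgD; [exact: cL|exact: cK].
Qed.

Definition dsum : representation G (L * K)%type :=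
  Representation dsumM dsum_continuous.

Lemma dsumE g x : dsum g x = (rhoL g x.1, rhoK g x.2).
Proof. exact: dsum_funE. Qed.

End DirectSum.

(* Main.v *)
Require Import Defs.
From HB Require Import structures.
From mathcomp Require Import all_boot all_order all_algebra.
From mathcomp Require Import all_classical all_reals all_analysis.
From mathcomp Require Import ring lra.

Set Implicit Arguments.
Unset Strict Implicit.
Unset Printing Implicit Defensive.

Import Order.TTheory GRing.Theory Num.Theory.
Import numFieldNormedType.Exports.

Local Open Scope classical_set_scope.
Local Open Scope ring_scope.

(** The identity component acts trivially on V and U, so it suffices to show that
a representation [rho] of a compact group G that is trivial on the identity
component has finite image. The intersection Q of all open subgroups of G is
connected: a clopen subset of Q extends, by compactness, to a clopen subset of
an open subgroup, whose stabiliser under right translations is an open subgroup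
and hence contains Q. So Q lies in the kernel, and by compactness some open
subgroup H is mapped by [rho] into any prescribed neighbourhood of 1. As GL_n has
no small subgroups, [rho] is trivial on H, hence locally constant, and its image
is finite by compactness. *)

(** * Locally constant maps on a compact space *)

Lemma locally_constant_finite_range (X : topologicalType) (Y : Type) (f : X -> Y) :
  compact [set: X] -> (forall x, \forall x' \near x, f x' = f x) ->
  finite_set (range f).
Proof.
move=> /compact_near_coveringP Xcov fconst.
(* Along [F], a set of values eventually contains any given finite set; compactness then turns the
   one-point ranges near each [x] into a single finite [D]. *)
pose F := filter_from (@finite_set Y) (fun D => [set E | D `<=` E]).
have FF : Filter F.
  apply: filter_from_filter; first by exists set0.
  move=> D D' finD finD'; exists (D `|` D'); first by rewrite finite_setU.
  by move=> E /=; rewrite subUset => -[].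
have [|D finD Df] := Xcov _ F (fun E x => E (f x)) FF.
  move=> x _; exists ([set x' | f x' = f x], [set E | [set f x] `<=` E]).
    split; first exact: fconst.
    by exists [set f x]; [exact: finite_set1|].
  by move=> [x' E] /= [-> fxE]; exact: fxE.
by apply: sub_finite_set finD => _ [x _ <-]; exact: (Df D).
Qed.

(** * Open subgroups of a compact group *)

Section TopologicalGroups.
Variable G : topGroupType.
Implicit Types (x g h : G) (H A B O V : set G).

Lemma cvgM_group T (F : set_system T) {FF : Filter F} (a b : T -> G) x y :
  a @ F --> x -> b @ F --> y -> (fun t => a t * b t)%g @ F --> (x * y)%g.
Proof.
by move=> ax by_; exact: (cvg_comp _ _ (cvg_pair ax by_) (@mulg_continuous G (x, y))).
Qed.

Lemma cvgV_group T (F : set_system T) {FF : Filter F} (a : T -> G) x :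
  a @ F --> x -> (fun t => (a t)^-1)%g @ F --> (x^-1)%g.
Proof. by move=> ax; exact: (cvg_comp _ _ ax (@invg_continuous G x)). Qed.

Lemma nbhs_translate V : nbhs 1%g V ->
  forall x, \forall x' \near x, V (x^-1 * x')%g.
Proof.
move=> V1 x.
have : (fun x' => x^-1 * x')%g @ x --> (x^-1 * x)%g.
  by apply: cvgM_group; [exact: cvg_cst|exact: cvg_id].
by rewrite mulVg; apply.
Qed.

Definition open_subgroup H := is_subgroup H /\ nbhs 1%g H.

Lemma open_subgroup_open H : open_subgroup H -> open H.
Proof.
move=> [[_ HM _] H1]; rewrite openE => x Hx.
apply: filterS (nbhs_translate H1 x) => y /(HM _ _ Hx).
by rewrite mulVKg.
Qed.

Lemma open_subgroup_closed H : open_subgroup H -> closed H.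
Proof.
move=> [[_ HM HV] H1] x clx.
have [y [Hy Hxy]] := clx _ (nbhs_translate H1 x).
by have := HM _ _ Hy (HV _ Hxy); rewrite invgM invgK mulVKg.
Qed.

Lemma open_subgroupT : open_subgroup [set: G].
Proof. by split; [split|exact: filterT]. Qed.

Lemma open_subgroupI A B :
  open_subgroup A -> open_subgroup B -> open_subgroup (A `&` B).
Proof.
move=> [[A1 AM AV] Ao] [[B1 BM BV] Bo]; split; last exact: filterI.
split=> //.
- by move=> x y [Ax Bx] [Ay By]; split; [exact: AM|exact: BM].
- by move=> x [Ax Bx]; split; [exact: AV|exact: BV].
Qed.

Definition open_core : set G :=
  [set x | forall H, open_subgroup H -> H x].

Lemma open_core_subgroup : is_subgroup open_core.
Proof.
split=> [H [[]]|x y Qx Qy H oH|x Qx H oH] //.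
- by have [[_ HM _] _] := oH; apply: HM; [exact: Qx|exact: Qy].
- by have [[_ _ HV] _] := oH; apply: HV; exact: Qx.
Qed.

Lemma open_core_closed : closed open_core.
Proof.
move=> x clx H oH; apply: open_subgroup_closed => // V Vx.
by have [y [Qy Vy]] := clx _ Vx; exists y; split => //; exact: Qy.
Qed.

Hypothesis G_compact : compact [set: G].

Lemma closed_compact_group A : closed A -> compact A.
Proof. by move=> Acl; exact: (subclosed_compact Acl G_compact). Qed.

Lemma open_subgroup_sub_nbhs O : open_core `<=` O° ->
  exists2 H, open_subgroup H & H `<=` O.
Proof.
move=> QO; pose F := filter_from open_subgroup id.
have FF : Filter F.
  apply: filter_from_filter; first by exists setT; exact: open_subgroupT.
  by move=> A B oA oB; exists (A `&` B) => //; exact: open_subgroupI.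
have /compact_near_coveringP cov : compact (~` O°).
  by apply: closed_compact_group; apply: open_closedC; exact: open_interior.
have [|H oH HO] := cov _ F (fun h x => x <> h) FF.
  move=> x Ox.
  have [H oH Hx] : exists2 H, open_subgroup H & ~ H x.
    apply: contrapT => nH; apply/Ox/QO => H oH.
    by apply: contrapT => Hx; apply: nH; exists H.
  exists (~` H, H).
    split; last by exists H.
    apply: open_nbhs_nbhs; split=> //.
    by apply: closed_openC; exact: open_subgroup_closed.
  by move=> [x' h] /= [nHx' Hh] x'h; apply: nHx'; rewrite x'h.
exists H => // h Hh; apply: interior_subset; apply: contrapT => nOh.
exact: (HO h Hh h nOh).
Qed.

(** Asking for both [g] and [g^-1] makes the set stable under inverses. It is a neighbourhood of 1
    because [A] is open and compact: one neighbourhood of 1 serves all [x] in [A] at once. *)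
Lemma clopen_stabilizer A : open A -> closed A ->
  open_subgroup [set g | forall x, A x -> A (x * g)%g /\ A (x * g^-1)%g].
Proof.
move=> Ao Acl; split; first split=> /=.
- by move=> x; rewrite invg1 mulg1.
- move=> g h Ag Ah x Ax; rewrite invgM !mulgA; split.
    by have [/Ah[]] := Ag _ Ax.
  by have [_ /Ag[]] := Ah _ Ax.
- by move=> g Ag x /Ag[]; rewrite invgK.
have /compact_near_coveringP cov := closed_compact_group Acl.
apply: (cov _ _ (fun g x => A (x * g)%g /\ A (x * g^-1)%g)) => x Ax.
have AN : nbhs x A by exact: open_nbhs_nbhs.
apply: filterI.
- suff : (fun p : G * G => p.1 * p.2)%g @ (x, 1%g) --> x by apply.
  by rewrite -[X in _ --> X]mulg1; apply: cvgM_group; [exact: cvg_fst|exact: cvg_snd].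
- suff : (fun p : G * G => p.1 * p.2^-1)%g @ (x, 1%g) --> x by apply.
  rewrite -[X in _ --> X]mulg1 -{2}invg1.
  by apply: cvgM_group; [exact: cvg_fst|apply: cvgV_group; exact: cvg_snd].
Qed.

(* G need not be Hausdorff, but it is regular, being a topological group. *)
Lemma compact_group_separation A B : closed A -> closed B -> A `&` B = set0 ->
  exists O O', [/\ A `<=` O°, B `<=` O'° & O `&` O' = set0].
Proof.
move=> Acl Bcl AB0.
have /compact_near_coveringP cov := closed_compact_group Acl.
have [|[W W'] [/= W1 W'1] AW] := cov _ (nbhs (1%g : G, 1%g : G))
    (fun w x => (~` B) (x * w.1 * w.2^-1)%g) (nbhs_filter _).
  move=> x Ax.
  have nB : nbhs x (~` B).
    apply: open_nbhs_nbhs; split; first exact: closed_openC.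
    by move=> Bx; rewrite -[False]/(set0 x) -AB0.
  suff : (fun p : G * (G * G) => p.1 * p.2.1 * p.2.2^-1)%g
      @ (x, (1%g, 1%g)) --> x by apply.
  have w1 : snd @ (x, (1%g : G, 1%g : G)) --> (1%g : G, 1%g : G).
    exact: cvg_snd.
  have xE : x = (x * 1 * 1^-1)%g by rewrite invg1 !mulg1.
  rewrite [X in _ --> X]xE.
  apply: cvgM_group; first apply: cvgM_group.
  - exact: cvg_fst.
  - by apply: (cvg_comp _ _ w1); exact: cvg_fst.
  - by apply: cvgV_group; apply: (cvg_comp _ _ w1); exact: cvg_snd.
(* [tr C V] is the product set CV. A common point aw = bw' of AW and BW' would give a w w'^-1 = b in
   B, against the choice of [W] and [W']. *)
pose tr C V : set G := [set y | exists2 x, C x & V (x^-1 * y)%g].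
have trI C V : nbhs (1%g : G) V -> C `<=` (tr C V)°.
  move=> V1 x Cx.
  by apply: filterS (nbhs_translate V1 x) => y Vy; exists x.
exists (tr A W), (tr B W'); split; [exact: trI|exact: trI|].
apply/seteqP; split=> // y [[a Aa Wa] [b Bb W'b]].
apply: (AW (a^-1 * y, b^-1 * y)%g _ a Aa) => //=.
by rewrite invgM invgK mulVKg mulVKg.
Qed.

Lemma open_core_connected : connected open_core.
Proof.
move=> B [b b_B] [C Co BE] [D Dcl BD].
have Bcl : closed B by rewrite BD; apply: closedI => //; exact: open_core_closed.
have B'cl : closed (open_core `\` C).
  by apply: closedI; [exact: open_core_closed|exact: open_closedC].
have [|P [P' [BP B'P' PP']]] := compact_group_separation Bcl B'cl.
  by rewrite BE; apply/seteqP; split=> // x [[_ Cx] [_ /(_ Cx)]].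
have [|H oH HO] := @open_subgroup_sub_nbhs (P° `|` P'°).
  have oU : open (P° `|` P'°) by apply: openU; exact: open_interior.
  move=> x Qx; apply: open_nbhs_nbhs; split=> //.
  by have [Cx|nCx] := pselect (C x); [left; apply: BP; rewrite BE|right; apply: B'P'].
have Hcl := open_subgroup_closed oH.
(* Both descriptions hold as [H] is covered by the disjoint sets [P°] and [P'°]; the first is open,
   the second closed. *)
have HPE : H `&` P° = H `\` P'°.
  apply/seteqP; split=> x [Hx].
    move=> /interior_subset Ox; split=> // /interior_subset P'x.
    by rewrite -[False]/(set0 x) -PP'.
  by move=> nP'x; split=> //; case: (HO _ Hx).
have Aop : open (H `&` P°).
  by apply: openI; [exact: open_subgroup_open|exact: open_interior].
have Acl : closed (H `&` P°).
  rewrite HPE; apply: closedI => //; apply: open_closedC; exact: open_interior.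
have stabo := clopen_stabilizer Aop Acl.
have [_ QM QV] := open_core_subgroup.
have Qb : open_core b by move: b_B; rewrite BE => -[].
apply/seteqP; split; first by rewrite BE => ? [].
move=> q Qq.
(* Right translation by b^-1 q, an element of the core and so of the stabiliser, carries [b] to [q];
   hence [q] stays in [P°] and cannot lie outside [C]. *)
have Qbq := QM _ _ (QV _ Qb) Qq.
have Ab : (H `&` P°) b by split; [exact: Qb|exact: BP].
have [+ _] := Qbq _ stabo b Ab.
rewrite mulVKg => -[_ /interior_subset Oq].
rewrite BE; split=> //; apply: contrapT => nCq.
rewrite -[False]/(set0 q) -PP'; split=> //.
by apply: interior_subset; apply: B'P'.
Qed.

Lemma open_core_sub_component : open_core `<=` identity_component G.
Proof.
apply: connected_component_max => //; last exact: open_core_connected.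
by have [] := open_core_subgroup.
Qed.

End TopologicalGroups.


(** * Absence of small subgroups and finiteness of the image *)

(** Squaring roughly doubles the distance to 1 near 1, so a uniform bound on a set closed under
    squaring shrinks by the factor 3/4, and repeating this drives it to 0. *)
Lemma square_closed_near1_trivial (R : realType) n (e : R) (S : set 'M[R]_n) :
    0 <= e -> n%:R * e <= 2^-1 ->
    (forall M, S M -> S (M *m M)) ->
    (forall M, S M -> forall i j, `|(M - 1%:M) i j| <= e) ->
  S `<=` [set 1%:M].
Proof.
move=> e0 ne SM Se.
have bnd k : forall M, S M -> forall i j, `|(M - 1%:M) i j| <= e * (3 / 4) ^+ k.
  elim: k => [|k IH] M S_M i j; first by rewrite mulr1; exact: Se.
  set d := e * (3 / 4) ^+ k in IH.
  have d0 : 0 <= d by apply: mulr_ge0 => //; apply: exprn_ge0; lra.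
  have nd : n%:R * d <= 2^-1.
    apply: le_trans ne; apply: ler_wpM2l => //.
    by rewrite -[leRHS]mulr1; apply: ler_wpM2l => //; apply: exprn_ile1; lra.
  set D := M - 1%:M in IH *.
  (* D *+ 2 = (M *m M - 1) - D *m D lets the bound e for the whole set improve
     itself: 2 |D| <= e + n e^2 <= (3/2) e. *)
  have DE : D *+ 2 = (M *m M - 1%:M) - D *m D.
    rewrite /D mulmxBl !mulmxBr !mulmx1 mul1mx mulr2n.
    by apply/matrixP => a b; rewrite !mxE; ring.
  have : `|(D *+ 2) i j| <= d + n%:R * d * d.
    rewrite DE mxE [in X in _ + X]mxE.
    apply: le_trans (ler_normB _ _) _; apply: lerD.
      exact: IH (SM _ S_M) i j.
    rewrite mxE; apply: le_trans (ler_norm_sum _ _ _) _.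
    rewrite -mulrA mulr_natl -[X in _ *+ X]card_ord -sumr_const.
    by apply: ler_sum => l _; rewrite normrM ler_pM // IH.
  rewrite mulmxnE normrMn => Dle.
  rewrite exprS mulrCA -/d; nra.
move=> M S_M /=; apply/eqP; rewrite -subr_eq0; apply/eqP/matrixP => i j.
rewrite [RHS]mxE; apply/eqP; rewrite -normr_le0.
have q1 : `|3 / 4 : R| < 1 by rewrite ger0_norm; lra.
have /cvg_lim lim0 := cvg_geometric e q1.
rewrite -[leRHS]lim0 //; apply: limr_ge; first exact/cvgP/cvg_geometric.
by apply: nearW => k; exact: bnd.
Qed.

Lemma rep_image_finite (R : realType) (G : topGroupType) (W : vectType R)
    (rho : representation G W) :
  compact [set: G] ->
  (forall g, identity_component G g -> rho g = 1%g) ->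
  finite_set (range rho).
Proof.
move=> G_compact rho1.
pose n := \dim {:W}.
have eB : basis_of {:W} (vbasis {:W}) := vbasisP _.
(* The factors are swapped because matrices act on row vectors; squares are unaffected. *)
have mxM (f g : GL W) : GLmx (f * g)%g = GLmx g *m GLmx f.
  by rewrite /GLmx (passmx.mxof_comp _ _ eB).
have mx1 : GLmx (1%g : GL W) = 1%:M.
  exact/passmx.mxof1/(basis_free eB).
(* With 2n + 1 in the denominator, n e is at most 1/2 and [e] is positive even when n = 0. *)
pose e : R := (n.*2.+1)%:R^-1.
have e0 : 0 < e by rewrite invr_gt0 ltr0n.
have ne : n%:R * e <= 2^-1.
  have eE : (n.*2.+1)%:R = n%:R * 2 + 1 :> R by rewrite -addn1 -muln2 natrD natrM.
  by rewrite /e eE ler_pdivrMr; have := ler0n R n; lra.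
pose O := [set g | forall i j, `|(GLmx (rho g) - 1%:M) i j| <= e].
have [|H oH HO] := @open_subgroup_sub_nbhs _ G_compact O.
  move=> q /(open_core_sub_component G_compact)/rho1 rhoq.
  apply: filter_forall => i; apply: filter_forall => j.
  have mC : (fun g => GLmx (rho g)) @ q --> (1%:M : 'M[R]_n).
    rewrite -mx1 -rhoq; apply: continuous_comp; first exact: rep_continuous.
    exact: initial_continuous.
  have := cvg_comp _ _ mC (@coord_continuous R _ _ i j 1%:M).
  move=> /cvgrPdist_le/(_ _ e0); apply: filterS => g /=.
  by rewrite distrC !mxE.
have [[H1 HM HV] _] := oH.
have rhoH g : H g -> rho g = 1%g.
  move=> Hg; apply/val_inj/(can_inj (passmx.mxofK eB eB)).
  rewrite -[LHS]/(GLmx (rho g)) -[RHS]/(GLmx 1%g) mx1.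
  apply: (@square_closed_near1_trivial R n e [set GLmx (rho g) | g in H]);
    [exact: ltW|exact: ne| | |by exists g].
  - by move=> _ [h Hh <-]; exists (h * h)%g; [exact: HM|rewrite repM mxM].
  - by move=> _ [h Hh <-]; exact: HO.
apply: locally_constant_finite_range => // x.
(* [rho] is constant on the coset xH, a neighbourhood of [x]. *)
apply: filterS (nbhs_translate oH.2 x) => y /rhoH rhoxy.
by rewrite -[y](mulVKg x) repM rhoxy mulg1.
Qed.

(** Being a finite group is expressed as being a subgroup of GL and a finite set; this supplies the
    first half. *)
Lemma rep_image_subgroup (R : realType) (G : topGroupType) (W : vectType R)
  (rho : representation G W) : is_subgroup (range rho).
Proof.
split; first by exists 1%g => //; exact: rep1.
- by move=> _ _ [x _ <-] [y _ <-]; exists (x * y)%g => //; exact: repM.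
- move=> _ [x _ <-]; exists (x^-1)%g => //.
  by apply: (mulgI (rho x)); rewrite -repM !mulgV rep1.
Qed.

Theorem mainTheorem4 (R : realType) (G : topGroupType)
    (G_compact : compact [set: G]) (L K : vectType R)
    (rhoL : representation G L) (rhoK : representation G K) :
  let V : {vspace L} := fixed_space rhoL (identity_component G) in
  let U : {vspace K} := fixed_space rhoK (identity_component G) in
  let rhoV : representation G (subvs_of V) :=
    subrep (fixed_identity_component_invariant rhoL) in
  let rhoU : representation G (subvs_of U) :=
    subrep (fixed_identity_component_invariant rhoK) in
  let rhoVU : representation G (subvs_of V * subvs_of U)%type :=
    dsum rhoV rhoU in
  is_subgroup (range rhoVU) /\ finite_set (range rhoVU).
Proof.
move=> V U rhoV rhoU rhoVU; split; first exact: rep_image_subgroup.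
apply: rep_image_finite => // g Gg; apply: GL_eqP => -[v u].
rewrite GL_oneE dsumE /=; congr pair; apply: subvs_inj.
- by rewrite (subrepE (fixed_identity_component_invariant rhoL));
    exact: (fixed_spaceP _ _ _).1 (subvsP v) _ Gg.
- by rewrite (subrepE (fixed_identity_component_invariant rhoK));
    exact: (fixed_spaceP _ _ _).1 (subvsP u) _ Gg.
Qed.
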